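(* Let $I$ be a nontrivial real interval (nonempty and not a singleton) and let $n\ge 2$ be an integer. A function $f\colon I^n\to I$ is continuous, symmetric, cancellative, and associative if and only if there exists a continuous and strictly monotonic function $\varphi\colon I\to J$ such that $$f(x_1,\dots,x_n)=\varphi^{-1}\Big(\sum_{i=1}^n \varphi(x_i)\Big)\quad\text{for all }x_1,\dots,x_n\in I,$$ where $J$ is a real interval of one of the forms $]-\infty,b[$, $]-\infty,b]$, $]a,\infty[$, $[a,\infty[$, or $\mathbb{R}=]-\infty,\infty[$, with $b\le 0\le a$. Moreover, for such a function $f$, the interval $I$ is necessarily open at least at one end, and $\varphi$ can be chosen to be strictly increasing; in other words, the $n$-ary semigroup $(I,f)$ is topologically order-isomorphic to the $n$-ary semigroup $(J,+)$.
   Context: A function $f\colon I^n\to I$ is associative if for each $i=1,\dots,n-1$ and all $x_1,\dots,x_{2n-1}\in I$: $f(x_1,\dots,x_{i-1},f(x_i,\dots,x_{i+n-1}),x_{i+n},\dots,x_{2n-1})=f(x_1,\dots,x_i,f(x_{i+1},\dots,x_{i+n}),x_{i+n+1},\dots,x_{2n-1})$; the pair $(I,f)$ is then called an $n$-ary semigroup. $f$ is cancellative if it is one-to-one in each variable: for every $k\in\{1,\dots,n\}$ and $\mathbf{x},\mathbf{x}'\in I^n$, if $x_i=x'_i$ for all $i\ne k$ and $f(\mathbf{x})=f(\mathbf{x}')$, then $x_k=x'_k$. $f$ is symmetric if $f(x_1,\dots,x_n)=f(x_{\sigma(1)},\dots,x_{\sigma(n)})$ for every permutation $\sigma$ of $\{1,\dots,n\}$.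 *)

(* Defs.v *)
From HB Require Import structures.
From mathcomp Require Import all_boot all_order all_algebra perm.
From mathcomp Require Import all_classical all_reals all_analysis.
Set Implicit Arguments. Unset Strict Implicit. Unset Printing Implicit Defensive.
Import Order.TTheory GRing.Theory Num.Theory.
Import numFieldNormedType.Exports.
Local Open Scope classical_set_scope.
Local Open Scope ring_scope.

Section Defs.
Variables (R : realType) (n : nat).

Definition cube (I : set R) : set 'rV[R]_n := [set x | forall i, I (x ord0 i)].

(* f(x_1,...,x_{i-1}, f(x_i,...,x_{i+n-1}), x_{i+n},...,x_{2n-1}), 0-indexed:
   x : nat -> R with x 0 .. x (2n-2) the arguments, i the (0-based) position. *)
Definition assoc_term (f : 'rV[R]_n -> R) (x : nat -> R) (i : nat) : R :=
  f (\row_(j < n) if (j < i)%N then x j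
                  else if j == i :> nat then f (\row_(k < n) x (i + k)%N)
                  else x (j + n - 1)%N).

Definition associative_on (I : set R) (f : 'rV[R]_n -> R) : Prop :=
  forall (i : nat) (x : nat -> R), (i.+1 < n)%N ->
    (forall k, (k < 2 * n - 1)%N -> I (x k)) ->
    assoc_term f x i = assoc_term f x i.+1.

Definition cancellative_on (I : set R) (f : 'rV[R]_n -> R) : Prop :=
  forall (k : ordinal n) (x x' : 'rV[R]_n), cube I x -> cube I x' ->
    (forall i, i != k -> x ord0 i = x' ord0 i) ->
    f x = f x' -> x ord0 k = x' ord0 k.

Definition symmetric_on (I : set R) (f : 'rV[R]_n -> R) : Prop :=
  forall (s : {perm 'I_n}) (x : 'rV[R]_n), cube I x ->
    f x = f (\row_(i < n) x ord0 (s i)).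

Definition strictly_increasing_on (I : set R) (phi : R -> R) : Prop :=
  forall x y, I x -> I y -> x < y -> phi x < phi y.

Definition strictly_decreasing_on (I : set R) (phi : R -> R) : Prop :=
  forall x y, I x -> I y -> x < y -> phi y < phi x.

Definition admissible_range (J : set R) : Prop :=
  exists a b : R, b <= 0 <= a /\
    (J = [set y | y < b] \/ J = [set y | y <= b] \/
     J = [set y | a < y] \/ J = [set y | a <= y] \/ J = setT).

Definition additive_representation (I : set R) (f : 'rV[R]_n -> R)
    (phi psi : R -> R) (J : set R) : Prop :=
  [/\ admissible_range J /\ phi @` I = J,
      {within I, continuous phi},
      (strictly_increasing_on I phi \/ strictly_decreasing_on I phi),
      ((forall x, I x -> psi (phi x) = x) /\ (forall y, J y -> I (psi y) /\ phi (psi y) = y))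
    & forall x, cube I x -> f x = psi (\sum_(i < n) phi (x ord0 i))].

Definition open_at_some_end (I : set R) : Prop :=
  ~ ((exists m, I m /\ forall x, I x -> m <= x) /\
     (exists M, I M /\ forall x, I x -> x <= M)).

End Defs.

(* Main.v *)
Require Import Defs.
From HB Require Import structures.
From mathcomp Require Import all_boot all_order all_algebra.
From mathcomp Require Import all_classical all_reals all_analysis.
From mathcomp Require Import perm ring lra zify.
Import Order.TTheory GRing.Theory Num.Theory.
Import numFieldNormedType.Exports.
Local Open Scope classical_set_scope.
Local Open Scope ring_scope.

(** Fix [c] in [I]. The binary operation [g u v = f (u, v, c, ..., c)] is
    commutative, associative, cancellative and continuous, so by a sign argument
    it is strictly increasing. If [p < g p p], continuity makes the ordered
    semigroup [(I, g)] Archimedean, even in the sense that [x < y] implies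
    [x^m p <= y^m] for some [m]; Hoelder's construction
    [h x = sup {(a - b) / m | p^a <= x^m p^b}] is then a strictly increasing
    homomorphism to [(R, +)], and it cannot jump because a jump would be
    translated everywhere. The case [g p p < p] follows by reflection.
    Exchanging each argument of [f] with [c] gives
    [h (f x) = sum_i h (x_i) - (n - 2) h c], and a translation of [h] absorbs
    the constant. *)

Set Implicit Arguments.
Unset Strict Implicit.

(** * Ordered commutative semigroups *)

Section OrderedSemigroup.
Context {disp : Order.disp_t} {T : orderType disp}.
Variable op : T -> T -> T.
Hypothesis opA : associative op.
Hypothesis opC : commutative op.
Hypothesis op_lt : forall x, {mono op x : y z / (y < z)%O}.

Lemma op_le x : {mono op x : y z / (y <= z)%O}.
Proof. by move=> y z; rewrite !leNgt op_lt. Qed.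

Lemma iter_op_le m x : {mono iter m (op x) : y z / (y <= z)%O}.
Proof. by elim: m => // m IH y z; rewrite /= op_le IH. Qed.

Lemma iter_op_lt m x : {mono iter m (op x) : y z / (y < z)%O}.
Proof. by move=> y z; rewrite !ltNge iter_op_le. Qed.

Lemma opCA : left_commutative op.
Proof. by move=> x y z; rewrite !opA (opC x). Qed.

Lemma iter_opCA m x w z : iter m (op x) (op w z) = op w (iter m (op x) z).
Proof. by elim: m => //= m ->; rewrite opCA. Qed.

Lemma iter_op_comm m k x y z :
  iter m (op x) (iter k (op y) z) = iter k (op y) (iter m (op x) z).
Proof. by elim: m => //= m ->; rewrite iter_opCA. Qed.

(** * Archimedean properties from order continuity *)

Section Continuous.
Variable p : T.
Hypothesis p_gt : forall z, (z < op p z)%O.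
Hypothesis dense : forall x y : T, (x < y)%O -> exists2 v, (x < v)%O & (v < y)%O.
(** Order completeness combined with left continuity of translations at the supremum; [op_right] is
    the matching right continuity. *)
Hypothesis op_sup : forall (A : set T) a M, A a -> (forall u, A u -> (u <= M)%O) ->
  exists2 L, forall u, A u -> (u <= L)%O &
    forall x v, (v < op x L)%O -> exists2 u, A u & (v < op x u)%O.
Hypothesis op_right : forall x L v, (op x L < v)%O ->
  exists2 L', (L < L')%O & (op x L' < v)%O.

(** A bounded orbit would have a supremum [L]; as [L < op p L], left continuity yields an orbit
    point whose successor exceeds [L]. *)
Lemma continuous_arch y z : exists m, (z < iter m (op p) y)%O.
Proof.
apply: contrapT => /forallNP H.
have [||L Lub Lad] := @op_sup [set iter m (op p) y | m in setT] y z.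
- by exists 0%N.
- by move=> _ [m _ <-]; rewrite leNgt; exact/negP/H.
- have [_ [m _ <-] Lu] := Lad p L (p_gt L).
  have : (iter m.+1 (op p) y <= L)%O by apply: Lub; exists m.+1.
  by rewrite leNgt Lu.
Qed.

(* If [x^m p z > y^m z] for all [m], the supremum [L] of the [u] with
   [x^m u <= y^m z] for some [m] would satisfy [x L >= y L]. *)
Lemma continuous_gap x y z : (x < y)%O ->
  exists2 m, (0 < m)%N & (iter m (op x) (op p z) <= iter m (op y) z)%O.
Proof.
move=> xy; apply: contrapT => H.
have {}H m : (0 < m)%N -> (iter m (op y) z < iter m (op x) (op p z))%O.
  by move=> m0; rewrite ltNge; apply/negP => ?; apply: H; exists m.
pose A := [set u | exists m, (iter m (op x) u <= iter m (op y) z)%O].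
have [||L Lub Lad] := @op_sup A z (op p z).
- by exists 0%N.
- move=> u [[|m]] /= hu; first exact: le_trans hu (ltW (p_gt z)).
  by have := le_lt_trans hu (H m.+1 isT); rewrite (iter_op_lt m.+1) => /ltW.
- have xyL : (op x L < op y L)%O by rewrite (opC x) (opC y) op_lt.
  have [v v1 v2] := dense xyL.
  have [L' LL' xL'] := op_right v1.
  have [u [m um] vu] := Lad _ _ v2.
  suff : (L' <= L)%O by rewrite leNgt LL'.
  apply: Lub; exists m.+1; rewrite iterSr.
  apply: (@le_trans _ _ (iter m (op x) (op y u))).
    by rewrite iter_op_le ltW// (lt_trans xL').
  by rewrite iter_opCA /= op_le.
Qed.

End Continuous.

(** * Hoelder's homomorphism to the reals *)

Section Holder.
Context {R : realType}.
Variable p : T.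
Hypothesis p_gt : forall z, (z < op p z)%O.
Hypothesis arch : forall y z, exists m, (z < iter m (op p) y)%O.
Hypothesis gap : forall x y z, (x < y)%O ->
  exists2 m, (0 < m)%N & (iter m (op x) (op p z) <= iter m (op y) z)%O.

Lemma iter_opM m x y z :
  iter m (op (op x y)) z = iter m (op x) (iter m (op y) z).
Proof.
by elim: m => //= m ->; rewrite -opA iter_opCA.
Qed.

(** Translating by [w] and exchanging [w] with [z] by commutativity lets [z] cancel, so the base
    point is immaterial. *)
Lemma iter_op_le_base x a b m z w :
  (iter a (op p) z <= iter m (op x) (iter b (op p) z))%O =
  (iter a (op p) w <= iter m (op x) (iter b (op p) w))%O.
Proof. by rewrite -(op_le w) -!iter_opCA (opC w) !iter_opCA op_le. Qed.

(* [(a - b) / m] is a lower bound for the ratio of [x] to [p]. *)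
Definition below x a b m := (iter a (op p) p <= iter m (op x) (iter b (op p) p))%O.

Lemma belowE z x a b m :
  below x a b m = (iter a (op p) z <= iter m (op x) (iter b (op p) z))%O.
Proof. exact: iter_op_le_base. Qed.

Lemma belowD x y a b c d m :
  below x a b m -> below y c d m -> below (op x y) (a + c) (b + d) m.
Proof.
rewrite /below => xab ycd; rewrite iterD.
apply: (@le_trans _ _ (iter a (op p) (iter m (op y) (iter d (op p) p)))).
  by rewrite iter_op_le.
rewrite iter_opM iterD (iter_op_comm m b y).
by rewrite -belowE.
Qed.

(** In a total order a failure of [below] is a strict inequality, and these multiply too; with
    [belowD] the ratio of [op x y] is bounded on both sides. *)
Lemma belowND x y a b c d m :
  ~~ below x a b m -> ~~ below y c d m -> ~~ below (op x y) (a + c) (b + d) m.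
Proof.
rewrite /below -!ltNge => xab ycd; rewrite [in ltRHS]iterD.
apply: (@lt_trans _ _ (iter a (op p) (iter m (op y) (iter d (op p) p)))).
  rewrite iter_opM iterD (iter_op_comm m b y).
  by rewrite ltNge -belowE /below -ltNge.
by rewrite iter_op_lt.
Qed.

Lemma below_add x a b m c d k :
  below x a b m -> below x c d k -> below x (a + c) (b + d) (m + k).
Proof.
rewrite /below => xab ycd; rewrite iterD.
apply: (@le_trans _ _ (iter a (op p) (iter k (op x) (iter d (op p) p)))).
  by rewrite iter_op_le.
rewrite !iterD (iter_op_comm k b x).
by rewrite -belowE.
Qed.

Lemma belowN_add x a b m c d k :
  ~~ below x a b m -> ~~ below x c d k -> ~~ below x (a + c) (b + d) (m + k).
Proof.
rewrite /below -!ltNge => xab ycd; rewrite [in ltRHS]iterD.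
apply: (@lt_trans _ _ (iter a (op p) (iter k (op x) (iter d (op p) p)))).
  rewrite !iterD (iter_op_comm k b x).
  by rewrite ltNge -belowE /below -ltNge.
by rewrite iter_op_lt.
Qed.

Lemma belowX x a b m k : below x a b m -> below x (k * a) (k * b) (k * m).
Proof.
move=> xab; elim: k => [|k IH]; first by rewrite /below !mul0n.
by rewrite !mulSn; exact: below_add.
Qed.

Lemma belowNX x a b m k : (0 < k)%N ->
  ~~ below x a b m -> ~~ below x (k * a) (k * b) (k * m).
Proof.
case: k => // k _ xab; elim: k => [|k IH]; first by rewrite !mul1n.
by rewrite (mulSn k.+1 a) (mulSn k.+1 b) (mulSn k.+1 m); exact: belowN_add.
Qed.

Lemma iterp_lt z : {mono (fun k => iter k (op p) z) : a b / (a < b)%N >-> (a < b)%O}.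
Proof.
apply: leW_mono; apply: le_mono => a b ab; exact: (homo_ltn (@lt_trans _ T)).
Qed.

(** This is [(a - b) / m < (c - d) / k] cleared of denominators and subtractions. At the common
    exponent [k * m] of [x], only powers of [p] remain to be compared. *)
Lemma below_ltn x a b m c d k :
  below x a b m -> ~~ below x c d k -> (0 < m)%N -> (0 < k)%N ->
  (k * a + m * d < m * c + k * b)%N.
Proof.
move=> xab xcd m0 k0.
have := belowX k xab; have := belowNX m0 xcd.
rewrite (mulnC k m).
rewrite (belowE (iter (k * b) (op p) p)) -ltNge -!iterD.
rewrite (belowE (iter (m * d) (op p) p)) -!iterD (addnC (k * b)%N).
by move=> /[swap] /le_lt_trans /[apply]; rewrite iterp_lt.
Qed.

Definition ratios x : set R := [set q | exists a b m,
  [/\ (0 < m)%N, q = (a%:R - b%:R) / m%:R & below x a b m]].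

Definition holder_hom x := sup (ratios x).

Lemma ratios_ub x c d k : (0 < k)%N -> ~~ below x c d k ->
  ubound (ratios x) ((c%:R - d%:R) / k%:R).
Proof.
move=> k0 xcd q [a [b [m [m0 -> xab]]]].
have := below_ltn xab xcd m0 k0.
rewrite -(ltr_nat R) !natrD !natrM => H.
rewrite ler_pdivlMr ?ltr0n// mulrAC ler_pdivrMr ?ltr0n//; nra.
Qed.

(** For [m > 0] this locates the ratio of [x] to [p] within [1 / m]. The shift [b] makes [a = 0]
    feasible even if [x] acts downwards, and [a] is then taken maximal. *)
Lemma below_exists x m : exists a b, below x a b m /\ ~~ below x a.+1 b m.
Proof.
have [b hb] := arch (iter m (op x) p) p.
have hb0 : below x 0 b m by rewrite /below /= iter_op_comm ltW.
have [c hc] := arch p (iter m (op x) (iter b (op p) p)).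
have hcN : ~~ below x c b m by rewrite /below -ltNge.
have ubc i : below x i b m -> (i <= c)%N.
  by move=> hi; rewrite ltnW// -(iterp_lt p); exact: le_lt_trans hi hc.
have [a ha hmax] := ex_maxnP (ex_intro (fun i => below x i b m) 0 hb0) ubc.
by exists a, b; split => //; apply/negP => /hmax; rewrite ltnn.
Qed.

Lemma ratios_has_sup x : has_sup (ratios x).
Proof.
have [a [b [h1 h2]]] := below_exists x 1.
split; first by exists ((a%:R - b%:R) / 1%:R); exists a, b, 1%N.
by exists ((a.+1%:R - b%:R) / 1%:R); exact: ratios_ub.
Qed.

Lemma below_le x a b m : (0 < m)%N -> below x a b m ->
  a%:R - b%:R <= m%:R * holder_hom x.
Proof.
move=> m0 xab; rewrite mulrC -ler_pdivrMr ?ltr0n//.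
apply: ub_le_sup; [by case: (ratios_has_sup x)|by exists a, b, m].
Qed.

Lemma belowN_ge x a b m : (0 < m)%N -> ~~ below x a b m ->
  m%:R * holder_hom x <= a%:R - b%:R.
Proof.
move=> m0 xab; rewrite mulrC -ler_pdivlMr ?ltr0n//.
by apply: ge_sup; [case: (ratios_has_sup x)|exact: ratios_ub].
Qed.

(** After multiplication by [m] both sides lie in the same interval of length 2, so they differ by
    at most [2 / m] for every positive [m]. *)
Lemma holder_homD x y : holder_hom (op x y) = holder_hom x + holder_hom y.
Proof.
have bnd m : (0 < m)%N ->
    m%:R * `|holder_hom (op x y) - (holder_hom x + holder_hom y)| <= 2%:R.
  move=> m0; rewrite -[X in X * `|_|](ger0_norm (ler0n R m)) -normrM.
  have [a [b [xab xabN]]] := below_exists x m.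
  have [c [d [ycd ycdN]]] := below_exists y m.
  have := below_le m0 xab; have := belowN_ge m0 xabN.
  have := below_le m0 ycd; have := belowN_ge m0 ycdN.
  have := below_le m0 (belowD xab ycd).
  have := belowN_ge m0 (belowND xabN ycdN).
  have SE i : i.+1%:R = i%:R + 1 :> R by rewrite natr1.
  rewrite !natrD !SE => *; rewrite ler_norml; lra.
apply/eqP; rewrite -subr_eq0 -normr_le0 leNgt; apply/negP => e0.
move: (`|_ - _|) bnd e0 => e bnd e0.
have := archi_boundP (divr_ge0 (ler0n R 2) (ltW e0)).
move: (Num.bound _) => m; rewrite ltr_pdivrMr// => hm.
have m0 : (0 < m)%N by case: m hm => // ; rewrite mul0r ltNge ler0n.
by have := lt_le_trans hm (bnd m m0); rewrite ltxx.
Qed.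

(** Locating [x] loses up to one unit and one use of [gap] gains one. Using [gap] twice, at exponent
    [2 * k], gains two units and leaves a strict margin. *)
Lemma holder_hom_lt x y : (x < y)%O -> holder_hom x < holder_hom y.
Proof.
move=> xy; have [k k0 hk] := gap p xy.
have [a [b [xab xabN]]] := below_exists x (2 * k).
have m0 : (0 < 2 * k)%N by rewrite muln_gt0.
have yab : below y (2 + a) b (2 * k).
  have base w : (iter k (op x) (op p w) <= iter k (op y) w)%O.
    by rewrite -(op_le p) -!iter_opCA (opC p w) (opCA p w) !iter_opCA op_le -iter_opCA.
  rewrite /below.
  rewrite iterD mul2n -addnn iterD /=.
  set B := iter b (op p) p in xab *.
  apply: (@le_trans _ _ (op p (op p (iter (k + k) (op x) B)))).
    by rewrite !op_le addnn -mul2n.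
  have -> : op p (op p (iter (k + k) (op x) B)) =
      iter k (op x) (op p (iter k (op x) (op p B))).
    by rewrite !iter_opCA iterD.
  by apply: le_trans (base _) _; rewrite iter_op_le.
have := belowN_ge m0 xabN; have := below_le m0 yab.
rewrite natrD natrM => h1; rewrite -natr1 => h2.
have : 0 < k%:R :> R by rewrite ltr0n.
nra.
Qed.
End Holder.

End OrderedSemigroup.

(** * Binary operations on an interval *)

Lemma within_continuousP (R : realType) (A : set R) (F : R -> R) :
  {within A, continuous F} <->
  forall x, A x -> forall e, 0 < e -> exists2 d, 0 < d &
    forall u, A u -> `|u - x| < d -> `|F u - F x| < e.
Proof.
rewrite subspace_continuousP; split => H x Ax.
  move=> e e0; have /cvgrPdist_lt/(_ e e0) := H x Ax.
  rewrite near_withinE => /nbhs_ballP[d /= d0 hd]; exists d => // u Au ux.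
  by rewrite distrC; apply: hd => //=; rewrite /ball /= distrC.
apply/cvgrPdist_lt => e e0; have [d d0 hd] := H x Ax e e0.
rewrite near_withinE; apply/nbhs_ballP; exists d => //= u ux Au.
by rewrite distrC; apply: hd; rewrite // distrC.
Qed.

Lemma within_continuous_lt (R : realType) (A : set R) (F : R -> R) x v :
  {within A, continuous F} -> A x -> F x < v ->
  exists2 d, 0 < d & forall u, A u -> `|u - x| < d -> F u < v.
Proof.
move=> /within_continuousP cF Ax Fv.
have [|d d0 hd] := cF x Ax (v - F x); first by rewrite subr_gt0.
exists d => // u Au ux; have := hd u Au ux; rewrite ltr_norml; lra.
Qed.

Lemma within_continuous_gt (R : realType) (A : set R) (F : R -> R) x v :
  {within A, continuous F} -> A x -> v < F x ->
  exists2 d, 0 < d & forall u, A u -> `|u - x| < d -> v < F u.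
Proof.
move=> /within_continuousP cF Ax Fv.
have [|d d0 hd] := cF x Ax (F x - v); first by rewrite subr_gt0.
exists d => // u Au ux; have := hd u Au ux; rewrite ltr_norml; lra.
Qed.

Section Binary.
Context {R : realType}.
Variables (I : set R) (g : R -> R -> R).
Hypothesis hI : is_interval I.
Hypothesis gI : forall x y, I x -> I y -> I (g x y).
Hypothesis gA : forall x y z, I x -> I y -> I z -> g x (g y z) = g (g x y) z.
Hypothesis gC : forall x y, I x -> I y -> g x y = g y x.
Hypothesis g_lt : forall x y z, I x -> I y -> I z -> y < z -> g x y < g x z.
Hypothesis g_cont : forall x, I x -> {within I, continuous (g x)}.

(** The semigroup lemmas need a total operation on an ordered type, hence the subtype with the
    induced order. *)
Definition carrier := {x : R | x \in I}.
HB.instance Definition _ := SubChoice.on carrier.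
HB.instance Definition _ := [SubChoice_isSubOrder of carrier by <: with ring_display].

Lemma lt_carrierE (x y : carrier) : (x < y)%O = (sval x < sval y).
Proof. exact: ltEsub. Qed.

Lemma le_carrierE (x y : carrier) : (x <= y)%O = (sval x <= sval y).
Proof. exact: leEsub. Qed.

Lemma carrierP (x : carrier) : I (sval x).
Proof. by have := valP x; rewrite inE. Qed.

Definition to_carrier x (Ix : I x) : carrier := exist _ x (mem_set Ix).

Definition gop (x y : carrier) : carrier := to_carrier (gI (carrierP x) (carrierP y)).

Lemma gopA : associative gop.
Proof. by move=> x y z; apply/val_inj/gA; exact: carrierP. Qed.

Lemma gopC : commutative gop.
Proof. by move=> x y; apply/val_inj/gC; exact: carrierP. Qed.

Lemma gop_lt x : {mono gop x : y z / (y < z)%O}.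
Proof.
apply: leW_mono; apply: le_mono => y z; rewrite !lt_carrierE.
by apply: g_lt; exact: carrierP.
Qed.

Lemma carrier_dense (x y : carrier) : (x < y)%O -> exists2 v, (x < v)%O & (v < y)%O.
Proof.
rewrite lt_carrierE => xy.
have Iv : I ((sval x + sval y) / 2).
  by apply: (hI (carrierP x) (carrierP y)); lra.
by exists (to_carrier Iv); rewrite lt_carrierE /=; lra.
Qed.

Lemma gop_sup (A : set carrier) a M : A a -> (forall u, A u -> (u <= M)%O) ->
  exists2 L, forall u, A u -> (u <= L)%O &
    forall x v, (v < gop x L)%O -> exists2 u, A u & (v < gop x u)%O.
Proof.
move=> Aa AM; pose B : set R := sval @` A.
have hB : has_sup B.
  split; first by exists (sval a), a.
  by exists (sval M) => _ [u Au <-]; rewrite -le_carrierE; exact: AM.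
have Bub u : A u -> sval u <= sup B by move=> Au; apply: ub_le_sup; [case: hB|exists u].
have IL : I (sup B).
  apply: (hI (carrierP a) (carrierP M)); rewrite Bub//=.
  by apply: ge_sup; [case: hB|move=> _ [u Au <-]; rewrite -le_carrierE; exact: AM].
exists (to_carrier IL) => [u Au|x v]; first by rewrite le_carrierE /= Bub.
rewrite lt_carrierE /= => vL.
have [d d0 hd] := within_continuous_gt (g_cont (carrierP x)) IL vL.
have [_ [u Au <-] uL] := sup_adherent d0 hB.
exists u => //; rewrite lt_carrierE; apply: hd; first exact: carrierP.
by have := Bub u Au; rewrite ltr_norml; lra.
Qed.

Section Positive.
Variable p : R.
Hypotheses (Ip : I p) (pp : p < g p p).

(** Translating by [p] turns the claim into [p z < (p p) z], where [z] cancels. *)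
Lemma gop_gt (z : carrier) : (z < gop (to_carrier Ip) z)%O.
Proof.
rewrite -(gop_lt (to_carrier Ip)) gopA -!(gopC z) gop_lt lt_carrierE //.
Qed.

Lemma gop_right x L v : (gop x L < v)%O ->
  exists2 L', (L < L')%O & (gop x L' < v)%O.
Proof.
rewrite lt_carrierE /= => Lv.
have [d d0 hd] := within_continuous_lt (g_cont (carrierP x)) (carrierP L) Lv.
(* The translate [M] of [L] by [p] lies in [I] above [L]; capping [L + d / 2] by it keeps the new
   point in [I]. *)
move: (gop _ L) (gop_gt L) => M; rewrite lt_carrierE => LM.
have IL' : I (Num.min (sval M) (sval L + d / 2)).
  apply: (hI (carrierP L) (carrierP M)).
  by rewrite le_min ge_min lexx /= andbT; apply/andP; split; lra.
exists (to_carrier IL'); rewrite lt_carrierE /=; first by rewrite lt_min; apply/andP; split; lra.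
apply: hd => //.
have : Num.min (sval M) (sval L + d / 2) <= sval L + d / 2 by rewrite ge_min lexx orbT.
have : sval L < Num.min (sval M) (sval L + d / 2) by rewrite lt_min; apply/andP; split; lra.
rewrite ltr_norml; lra.
Qed.

Lemma aczel_increasing_hom : exists h : R -> R,
  (forall x y, I x -> I y -> h (g x y) = h x + h y) /\
  (forall x y, I x -> I y -> x < y -> h x < h y).
Proof.
pose q := to_carrier Ip.
have arch := continuous_arch gop_gt gop_sup.
have gap := continuous_gap gopA gopC gop_lt gop_gt carrier_dense gop_sup gop_right.
pose h (x : carrier) : R := holder_hom gop q x.
(* Extension from the subtype to [R], with default 0 outside [I]. *)
pose h0 x := if pselect (I x) is left Ix then h (to_carrier Ix) else 0.
have h0E x (Ix : I x) : h0 x = h (to_carrier Ix).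
  by rewrite /h0; case: pselect => // Ix'; congr h; exact: val_inj.
exists h0; split => [x y Ix Iy|x y Ix Iy xy].
  rewrite (h0E _ (gI Ix Iy)) (h0E _ Ix) (h0E _ Iy).
  rewrite -(holder_homD gopA gopC gop_lt gop_gt arch).
  by congr holder_hom; exact: val_inj.
rewrite (h0E _ Ix) (h0E _ Iy).
by apply: (holder_hom_lt gopA gopC gop_lt gop_gt arch gap); rewrite lt_carrierE.
Qed.

End Positive.

(** Bisection: one half of an interval carries at most half of the increment of [h], so [k] halvings
    leave at most a fraction [2 ^- k] of it. *)
Lemma hom_small_increment (h : R -> R) :
  (exists x y, I x /\ I y /\ x < y) ->
  (forall x y, I x -> I y -> x < y -> h x < h y) ->
  forall e, 0 < e -> exists x y, [/\ I x, I y, x < y & h y - h x < e].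
Proof.
move=> [x [y [Ix [Iy xy]]]] h_lt e e0.
have H k : exists a b, [/\ I a, I b, a < b & (h b - h a) * 2 ^+ k <= h y - h x].
  elim: k => [|k [a [b [Ia Ib ab hab]]]].
    by exists x, y; split => //; rewrite expr0 mulr1.
  have Im : I ((a + b) / 2) by apply: (hI Ia Ib); lra.
  have am : a < (a + b) / 2 by lra.
  have mb : (a + b) / 2 < b by lra.
  have k0 : 0 < 2 ^+ k :> R by rewrite exprn_gt0.
  have [l|l] := leP (h b - h ((a + b) / 2)) (h ((a + b) / 2) - h a).
    by exists ((a + b) / 2), b; split => //; rewrite exprS; nra.
  by exists a, ((a + b) / 2); split => //; rewrite exprS; nra.
have hxy : 0 < h y - h x by rewrite subr_gt0 h_lt.
have := archi_boundP (divr_ge0 (ltW hxy) (ltW e0)).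
move: (Num.bound _) => m; rewrite ltr_pdivrMr// => hm.
have [a [b [Ia Ib ab hab]]] := H m; exists a, b; split => //.
have m2 : m%:R <= 2 ^+ m :> R by rewrite -natrX ler_nat ltnW// ltn_expl.
have m0 : 0 < 2 ^+ m :> R by rewrite exprn_gt0.
have := h_lt a b Ia Ib ab; nra.
Qed.

(* A jump of size [e] at [x0] would force every increment of [h] to be at least [e]. *)
Lemma hom_continuous (h : R -> R) :
  (exists x y, I x /\ I y /\ x < y) ->
  (forall x y, I x -> I y -> h (g x y) = h x + h y) ->
  (forall x y, I x -> I y -> x < y -> h x < h y) ->
  {within I, continuous h}.
Proof.
move=> nontriv hD h_lt; apply/within_continuousP => x0 Ix0 e e0.
have [z [z' [Iz Iz' zz' hzz']]] := hom_small_increment nontriv h_lt e0.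
(* Both strict inequalities persist when [u] near [x0] replaces [x0] on the side of [z],
   respectively [z']; applying [h] bounds [h u - h x0] by [h z' - h z < e] in absolute value. *)
have lt1 : g z x0 < g x0 z' by rewrite gC// g_lt.
have lt2 : g x0 z < g z' x0 by rewrite (gC Iz')// g_lt.
have [d d0 hd] := within_continuous_lt (g_cont Iz) Ix0 lt1.
have [d' d'0 hd'] := within_continuous_gt (g_cont Iz') Ix0 lt2.
exists (Num.min d d'); first by rewrite lt_min d0.
move=> u Iu; rewrite lt_min => /andP[ud ud'].
have := h_lt _ _ (gI Iz Iu) (gI Ix0 Iz') (hd u Iu ud).
have := h_lt _ _ (gI Ix0 Iz) (gI Iz' Iu) (hd' u Iu ud').
rewrite !hD// ltr_norml; lra.
Qed.

End Binary.

Lemma within_continuous_image_interval (R : realType) (I : set R) (F : R -> R) :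
  is_interval I -> {within I, continuous F} -> is_interval (F @` I).
Proof.
by move=> /connected_intervalP cI cF; apply/connected_intervalP/connected_continuous_connected.
Qed.

Lemma within_continuous_reflect (R : realType) (I : set R) (F : R -> R) :
  {within I, continuous F} ->
  {within [set x | I (- x)], continuous (fun x => - F (- x))}.
Proof.
move=> /within_continuousP cF; apply/within_continuousP => x Ix e e0.
have [d d0 hd] := cF _ Ix e e0; exists d => // u Iu ux.
by rewrite -opprD normrN hd// -opprD normrN.
Qed.

(** * Cancellative continuous operations *)

Section CancellativeBinary.
Context {R : realType}.
Variables (I : set R) (g : R -> R -> R).
Hypothesis hI : is_interval I.
Hypothesis gI : forall x y, I x -> I y -> I (g x y).
Hypothesis gA : forall x y z, I x -> I y -> I z -> g x (g y z) = g (g x y) z.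
Hypothesis gC : forall x y, I x -> I y -> g x y = g y x.
Hypothesis g_cancel : forall x y z, I x -> I y -> I z -> g x y = g x z -> y = z.
Hypothesis g_cont : forall x, I x -> {within I, continuous (g x)}.

(* If [g x] were decreasing then [g (g x x)], that is [g x \o g x], would be
   increasing, and the sign of [g z u - g y u] would change between [x] and [g x x]. *)
Lemma cancellative_lt x y z : I x -> I y -> I z -> y < z -> g x y < g x z.
Proof.
move=> Ix Iy Iz yz; rewrite ltNge; apply/negP => xzy.
have gxN : g x z < g x y.
  rewrite lt_neqAle xzy andbT; apply/eqP => /(g_cancel Ix Iz Iy) zy.
  by rewrite zy ltxx in yz.
have gx_anti u v : I u -> I v -> u < v -> g x v < g x u.
  have RI w : (w \in Rhull I) <-> I w by rewrite {2}((is_intervalP I).1 hI).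
  have gxC : {within [set` Rhull I], continuous (g x)}.
    by rewrite -(is_intervalP _).1 //; exact: g_cont.
  have gx_inj : {in Rhull I &, injective (g x)}.
    by move=> a b /RI Ia /RI Ib; exact: g_cancel.
  case: (itv_continuous_inj_mono gxC gx_inj) => gx_mono /RI Iu /RI Iv uv.
    have := gx_mono _ _ ((RI y).2 Iy) ((RI z).2 Iz) yz.
    by rewrite ltNge xzy.
  exact: gx_mono.
have cD : {within I, continuous (fun u => g z u - g y u)}.
  by move=> u; apply: continuousB; exact: g_cont.
have [u Iu] : ((fun u => g z u - g y u) @` I) 0.
  apply: (within_continuous_image_interval hI cD (x := g z x - g y x) (y := g z (g x x) - g y (g x x))).
  - by exists x.
  - by exists (g x x) => //; exact: gI.
  - rewrite (gC Iz Ix) (gC Iy Ix) (gA Iz Ix Ix) (gA Iy Ix Ix).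
    rewrite (gC Iz Ix) (gC Iy Ix) (gC (gI Ix Iz) Ix) (gC (gI Ix Iy) Ix).
    have := gx_anti _ _ (gI Ix Iz) (gI Ix Iy) gxN.
    by move=> ?; apply/andP; split; lra.
move/eqP; rewrite subr_eq0 => /eqP; rewrite (gC Iz Iu) (gC Iy Iu) => /(g_cancel Iu Iz Iy) zy.
by rewrite zy ltxx in yz.
Qed.

Theorem aczel_positive p : I p -> p < g p p -> exists h : R -> R,
  [/\ forall x y, I x -> I y -> h (g x y) = h x + h y,
      forall x y, I x -> I y -> x < y -> h x < h y
    & {within I, continuous h}].
Proof.
move=> Ip pp.
have [h [hD h_lt]] := aczel_increasing_hom hI gI gA gC cancellative_lt g_cont Ip pp.
exists h; split => //; apply: (hom_continuous hI gI gC cancellative_lt g_cont) => //.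
by exists p, (g p p); split => //; split => //; exact: gI.
Qed.
End CancellativeBinary.

Theorem aczel (R : realType) (I : set R) (g : R -> R -> R) :
  is_interval I -> (exists x y, I x /\ I y /\ x != y) ->
  (forall x y, I x -> I y -> I (g x y)) ->
  (forall x y z, I x -> I y -> I z -> g x (g y z) = g (g x y) z) ->
  (forall x y, I x -> I y -> g x y = g y x) ->
  (forall x y z, I x -> I y -> I z -> g x y = g x z -> y = z) ->
  (forall x, I x -> {within I, continuous (g x)}) ->
  exists h : R -> R,
  [/\ forall x y, I x -> I y -> h (g x y) = h x + h y,
      forall x y, I x -> I y -> x < y -> h x < h y
    & {within I, continuous h}].
Proof.
move=> hI [a [b [Ia [Ib ab]]]] gI gA gC g_cancel g_cont.
have [p Ip] : exists2 p, I p & p != g p p.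
  apply: contrapT => H.
  (* If all points were idempotent, [g a (g a b) = g (g a a) b = g a b] would give
     [g a b = b = g b b], and cancelling [b] would give [a = b]. *)
  have idem x : I x -> g x x = x.
    by move=> Ix; apply/eqP; rewrite eq_sym; apply: contrapT => /negP ?; apply: H; exists x.
  move/eqP: ab; apply.
  have e : g a b = b.
    by apply: (g_cancel a); rewrite ?gA ?idem//; exact: gI.
  by apply: (g_cancel b) => //; rewrite (gC b a)// e idem.
rewrite neq_lt => /orP[|ppN]; first exact: aczel_positive.
(* Reflection turns [g p p < p] into the positive case at [- p]; reflecting [h] back keeps it
   increasing. *)
pose I' := [set x | I (- x)]; pose g' x y := - g (- x) (- y).
have [||||||||h [hD h_lt hc]] := @aczel_positive R I' g' _ _ _ _ _ _ (- p) _ _.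
- move=> x y Ix Iy z /andP[xz zy]; apply: (hI _ _ Iy Ix); by rewrite !lerN2 zy.
- by move=> x y Ix Iy; rewrite /I' /g' /= opprK; exact: gI.
- by move=> x y z Ix Iy Iz; rewrite /g' !opprK gA.
- by move=> x y Ix Iy; rewrite /g' gC.
- by move=> x y z Ix Iy Iz /oppr_inj/(g_cancel _ _ _ Ix Iy Iz)/oppr_inj.
- by move=> x Ix; exact: (within_continuous_reflect (g_cont _ Ix)).
- by rewrite /I' /= opprK.
- by rewrite /g' !opprK ltrN2.
exists (fun x => - h (- x)); split => [x y Ix Iy|x y Ix Iy xy|].
- have := hD (- x) (- y); rewrite /g' /I' /= !opprK => -> //.
  by rewrite opprD.
- by rewrite ltrN2 h_lt /I' /= ?opprK ?ltrN2.
- have := within_continuous_reflect hc.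
  by rewrite (_ : [set x | I' (- x)] = I)//; apply/seteqP; split => x; rewrite /I' /= opprK.
Qed.

(** * Reduction of the n-ary case *)

Section Nary.
Context {R : realType} {m : nat}.
Variables (I : set R) (f : 'rV[R]_m.+2 -> R).
Hypothesis hI : is_interval I.
Hypothesis nontriv : exists x y, I x /\ I y /\ x != y.
Hypothesis fI : forall x, cube I x -> I (f x).
Hypothesis f_cont : {within cube I, continuous f}.
Hypothesis f_sym : symmetric_on I f.
Hypothesis f_cancel : cancellative_on I f.
Hypothesis f_assoc : associative_on I f.
Variable c : R.
Hypothesis Ic : I c.

Let row2 u v : 'rV[R]_m.+2 :=
  \row_j if j == 0 :> nat then u else if j == 1 :> nat then v else c.
Let g u v := f (row2 u v).

Let set_coord (x : 'rV[R]_m.+2) (k : 'I_m.+2) y : 'rV[R]_m.+2 :=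
  \row_j if j == k then y else x ord0 j.

Lemma cube_row2 u v : I u -> I v -> cube I (row2 u v).
Proof. by move=> Iu Iv j; rewrite mxE; do 2 (case: ifP => //). Qed.

Lemma binopI u v : I u -> I v -> I (g u v).
Proof. by move=> Iu Iv; exact/fI/cube_row2. Qed.

Lemma cube_set_coord x k y : cube I x -> I y -> cube I (set_coord x k y).
Proof. by move=> Ix Iy j; rewrite mxE; case: ifP. Qed.

Lemma binopC u v : I u -> I v -> g u v = g v u.
Proof.
move=> Iu Iv; rewrite /g (f_sym (tperm (inord 0) (inord 1)) (cube_row2 Iu Iv)).
congr f; apply/rowP => j; rewrite !mxE.
have v0 : (inord 0 : 'I_m.+2) = 0%N :> nat by rewrite inordK.
have v1 : (inord 1 : 'I_m.+2) = 1%N :> nat by rewrite inordK.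
case: tpermP => [->|->|/eqP j0 /eqP j1]; rewrite ?v0 ?v1//.
by move: j0 j1; rewrite -!val_eqE /= v0 v1 => /negPf-> /negPf->.
Qed.

(* Apply associativity at positions 0 and 1 to the word [y, r, x_k, c, ..., c],
   where [r] lists the [x_j] with [j != k]. *)
Lemma binop_swap x k y : cube I x -> I y ->
  g (f x) y = g (f (set_coord x k y)) (x ord0 k).
Proof.
move=> Ix Iy.
pose X t := if t == 0%N then y else if (t < m.+2)%N then x ord0 (lift k (inord t.-1))
  else if t == m.+2 then x ord0 k else c.
have XI t : (t < 2 * m.+2 - 1)%N -> I (X t).
  by move=> _; rewrite /X; do 3 (case: ifP => // _).
have := f_assoc (isT : (1 < m.+2)%N) XI.
(* [lift_perm ord0 k 1] sends index 0 to [k] and keeps the others in order, so [y, r] rearranges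
   [set_coord x k y]; [ord_max] does the same for [r, x_k] and [x]. *)
have w0 : f (\row_j X (0 + j)%N) = f (set_coord x k y).
  rewrite [RHS](f_sym (lift_perm ord0 k 1)); last exact: cube_set_coord.
  congr f; apply/rowP => j; rewrite !mxE /X add0n.
  have [t ->|->] := unliftP ord0 j.
    rewrite lift_perm_lift perm1 lift0 /= ltnS ltn_ord inord_val.
    by rewrite eq_sym (negPf (neq_lift _ _)).
  by rewrite lift_perm_id !eqxx.
have w1 : f (\row_j X (1 + j)%N) = f x.
  rewrite [RHS](f_sym (lift_perm ord_max k 1)) //.
  congr f; apply/rowP => j; rewrite !mxE /X add1n.
  have [t ->|->] := unliftP ord_max j.
    by rewrite lift_perm_lift perm1 lift_max /= ltnS ltn_ord inord_val.
  by rewrite lift_perm_id /= ltnn eqxx.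
rewrite /assoc_term w0 w1 => e.
rewrite (binopC (fI Ix) Iy) /g.
transitivity (f (\row_(j < m.+2)
       (if (j < 1)%N
        then X j
        else if j == 1 :> nat then f x else X (j + m.+2 - 1)%N))).
  congr f; apply/rowP => -[[|[|j]] jm]; rewrite !mxE //=.
  rewrite /X; case: eqP; first lia.
  case: ifP; first lia.
  by case: eqP; first lia.
rewrite -e; congr f; apply/rowP => -[[|[|j]] jm]; rewrite !mxE //=.
- by rewrite /X add1n subn1 /= ltnn eqxx.
- rewrite /X; case: eqP; first lia.
  case: ifP; first lia.
  by case: eqP; first lia.
Qed.

(** Up to commutativity, this exchanges the outer argument [x] with coordinate 0 of [g z y]. *)
Lemma binopA x y z : I x -> I y -> I z -> g x (g y z) = g (g x y) z.
Proof.
move=> Ix Iy Iz; rewrite (binopC Ix (binopI Iy Iz)).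
rewrite (binopC Iy Iz).
have := binop_swap (inord 0) (cube_row2 Iz Iy) Ix.
rewrite /g => ->; congr f; congr row2; last by rewrite mxE inordK.
congr f; apply/rowP => j; rewrite !mxE -val_eqE /= inordK//.
by case: eqP => //.
Qed.

Lemma binop_cancel x y z : I x -> I y -> I z -> g x y = g x z -> y = z.
Proof.
move=> Ix Iy Iz gxyz.
have := f_cancel (k := inord 1) (cube_row2 Ix Iy) (cube_row2 Ix Iz).
rewrite !mxE inordK//=; apply => // i; rewrite -val_eqE /= inordK// !mxE.
by move=> /negPf->.
Qed.

Lemma binop_cont x : I x -> {within I, continuous (g x)}.
Proof.
move=> Ix; apply/subspace_continuousP => y Iy; apply/cvgrPdist_lt => e e0.
have /cvgrPdist_lt/(_ e e0) := (subspace_continuousP _ _).1 f_cont _ (cube_row2 Ix Iy).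
rewrite !near_withinE => /nbhs_ballP[d /= d0 hd]; apply/nbhs_ballP.
exists d => // u yu Iu; apply: hd; last exact: cube_row2.
split => // i j; rewrite !mxE; case: ifP => _; first exact: ballxx.
by case: ifP => // _; exact: ballxx.
Qed.

Lemma nary_additive : exists phi : R -> R,
  [/\ forall x, cube I x -> phi (f x) = \sum_(i < m.+2) phi (x ord0 i),
      forall x y, I x -> I y -> x < y -> phi x < phi y
    & {within I, continuous phi}].
Proof.
have [h [hD h_lt h_cont]] := aczel hI nontriv binopI binopA binopC binop_cancel binop_cont.
(* The defect of additivity. Applying [h] to [binop_swap] shows that replacing a coordinate by [c]
   preserves it. *)
pose E x := h (f x) - \sum_(i < m.+2) h (x ord0 i).
have E_set x (k : 'I_m.+2) : cube I x -> E (set_coord x k c) = E x.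
  move=> Ix; have := congr1 h (binop_swap k Ix Ic).
  rewrite (hD _ _ (fI Ix) Ic) (hD _ _ (fI (cube_set_coord k Ix Ic)) (Ix k)).
  rewrite /E (@bigD1 _ _ _ _ k xpredT) //= (@bigD1 _ _ _ _ k xpredT (fun i => h (x ord0 i))) //= mxE eqxx.
  rewrite (eq_bigr (fun i => h (x ord0 i))); last by move=> i /negPf ik; rewrite mxE ik.
  lra.
have E_const x : cube I x -> E x = h c + h c - (m.+2)%:R * h c.
  (* Replacing coordinates one at a time leads from [x] to the constant row, where [f] equals
     [g c c]. *)
  move=> Ix; pose X t : 'rV[R]_m.+2 := \row_j if (j < t)%N then c else x ord0 j.
  have IX t : cube I (X t) by move=> j; rewrite mxE; case: ifP.
  have EX t : (t <= m.+2)%N -> E (X t) = E x.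
    elim: t => [_|t IH tm]; first by congr E; apply/rowP => j; rewrite mxE.
    rewrite -(IH (ltnW tm)) -[RHS](E_set (X t) (inord t) (IX t)); congr E.
    apply/rowP => j; rewrite !mxE -val_eqE /= inordK// ltnS leq_eqVlt.
    by case: eqP.
  rewrite -(EX m.+2) // /E.
  have -> : X m.+2 = row2 c c by apply/rowP => j; rewrite !mxE ltn_ord; do 2 (case: ifP => //).
  rewrite -/(g c c) hD//; congr (_ - _).
  rewrite (eq_bigr (fun=> h c)) ?sumr_const ?card_ord ?mulr_natl//.
  by move=> i _; rewrite mxE; do 2 (case: ifP => //).
(* The defect is [- m * h c]; subtracting [s] from [h] adds [m.+1 * s] to it, which must make it
   vanish. *)
pose s := m%:R / m.+1%:R * h c.
exists (fun x => h x - s); split.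
- move=> x Ix; have := E_const x Ix; rewrite /E => /eqP; rewrite subr_eq => /eqP ->.
  rewrite big_split /= sumr_const card_ord -[_ *+ m.+2]mulr_natl /s.
  have : m.+1%:R != 0 :> R by rewrite pnatr_eq0.
  rewrite -(natr1 m.+1) -(natr1 m) => ?; field.
  by [].
- by move=> x y Ix Iy xy; rewrite ltrD2r h_lt.
- apply/within_continuousP => x Ix e e0.
  have [d d0 hd] := (within_continuousP _ _).1 h_cont x Ix e e0.
  exists d => // u Iu ux; rewrite opprB addrA subrK; exact: hd.
Qed.
End Nary.

(** * The range of the representation *)

Section AdmissibleRange.
Context {R : realType}.

Lemma dilation_unbounded (n : nat) (J : set R) y u : (1 < n)%N ->
  (forall y, J y -> J (n%:R * y)) -> J y -> 0 < y -> exists2 w, J w & u < w.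
Proof.
move=> n1 Jn Jy y0.
have Jk k : J (n%:R ^+ k * y).
  by elim: k => [|k IH]; rewrite ?expr0 ?mul1r// exprS -mulrA; exact: Jn.
have [u0|u0] := ltP u 0; first by exists y => //; exact: lt_trans y0.
have := archi_boundP (divr_ge0 u0 (ltW y0)).
move: (Num.bound _) => k; rewrite ltr_pdivrMr// => uk.
exists (n%:R ^+ k * y) => //; apply: (lt_le_trans uk).
by rewrite ler_pM2r// -natrX ler_nat ltnW// ltn_expl.
Qed.

(** Dilation would push elements past a negative infimum, so [inf J >= 0]. Dilates of a positive
    element are unbounded, and convexity fills everything above [inf J]. *)
Lemma dilation_stable_bounded_below (n : nat) (J : set R) : (1 < n)%N ->
  is_interval J -> (forall y, J y -> J (n%:R * y)) ->
  (exists2 y, J y & y != 0) -> has_lbound J ->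
  exists2 a, 0 <= a & J = [set y | a < y] \/ J = [set y | a <= y].
Proof.
move=> n1 hJ Jn [y Jy y0] lbJ; have hinf : has_inf J by split=> //; exists y.
have Jge u : J u -> inf J <= u by move=> Ju; exact: ge_inf.
have a0 : 0 <= inf J.
  rewrite leNgt; apply/negP => a0.
  (* This tolerance gives [u < inf J / 2 < 0], hence [n * u <= 2 * u < inf J]. *)
  have [||u Ju ua] := @inf_adherent _ J (- inf J / 2) => //; first by lra.
  have := Jge _ (Jn _ Ju).
  have : 2%:R <= n%:R :> R by rewrite ler_nat.
  nra.
have ypos : 0 < y by rewrite lt_neqAle eq_sym y0 (le_trans a0)// Jge.
have Jgt v : inf J < v -> J v.
  move=> av; have [||u Ju uv] := @inf_adherent _ J (v - inf J) => //; first by lra.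
  have [w Jw vw] := dilation_unbounded v n1 Jn Jy ypos.
  by apply: (hJ u w) => //; lra.
exists (inf J) => //; have [Ja|Ja] := pselect (J (inf J)); [right|left].
  apply/seteqP; split => v /=; first exact: Jge.
  by rewrite le_eqVlt => /predU1P[<-//|]; exact: Jgt.
apply/seteqP; split => v /=; last exact: Jgt.
move=> Jv; rewrite lt_neqAle Jge// andbT; apply/eqP => e.
by apply: Ja; rewrite e.
Qed.

(** The case bounded above reflects to the case bounded below; if unbounded both ways, [J] is all of
    [R] by convexity. *)
Lemma dilation_stable_admissible (n : nat) (J : set R) : (1 < n)%N ->
  is_interval J -> (forall y, J y -> J (n%:R * y)) ->
  (exists2 y, J y & y != 0) -> admissible_range J.
Proof.
move=> n1 hJ Jn [y Jy y0].
have [lbJ|lbN] := pselect (has_lbound J).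
  have [a a0 Ja] := dilation_stable_bounded_below n1 hJ Jn (ex_intro2 _ _ y Jy y0) lbJ.
  exists a, 0; rewrite a0 lexx; split => //; case: Ja; tauto.
have [[b ubJ]|ubN] := pselect (has_ubound J).
  have [||||a a0 Ja] := @dilation_stable_bounded_below n [set y | J (- y)] n1.
  - move=> u v Ju Jv z /andP[uz zv]; apply: (hJ _ _ Jv Ju); lra.
  - by move=> u Ju /=; rewrite -mulrN; exact: Jn.
  - by exists (- y); rewrite /= ?opprK ?oppr_eq0.
  - by exists (- b) => u Ju; rewrite lerNl; exact: ubJ.
  have JE v : J v = [set y | J (- y)] (- v) by rewrite /= opprK.
  exists 0, (- a); split; first by rewrite lexx; lra.
  case: Ja => Ja; [left|right; left]; apply/seteqP;
    by split => v; rewrite JE Ja /=; lra.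
exists 0, 0; rewrite lexx; split => //; do 4 right; apply/seteqP; split => // v _.
have [u Ju uv] : exists2 u, J u & u < v.
  apply: contrapT => H; apply: lbN; exists v => u Ju.
  by rewrite leNgt; apply/negP => ?; apply: H; exists u.
have [w Jw vw] : exists2 u, J u & v < u.
  apply: contrapT => H; apply: ubN; exists v => w Jw.
  by rewrite leNgt; apply/negP => ?; apply: H; exists w.
by apply: (hJ _ _ Ju Jw); lra.
Qed.

Lemma admissible_unbounded (J : set R) l u : admissible_range J ->
  ~ (forall y, J y -> l <= y <= u).
Proof.
move=> [a [b [ab HJ]]] H.
(* Two test points outside [[l, u]]; every admissible shape contains at least one of them. *)
have lt_max : u < Num.max u a + 1 by rewrite ltr_pwDr// le_max lexx.
have ge_max : a < Num.max u a + 1 by rewrite ltr_pwDr// le_max lexx orbT.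
have gt_min : Num.min l b - 1 < l.
  by rewrite ltrBlDr ltr_pwDr// ge_min lexx.
have le_min : Num.min l b - 1 < b.
  by rewrite ltrBlDr ltr_pwDr// ge_min lexx orbT.
have H1 : ~ J (Num.max u a + 1) by move=> /H; lra.
have H2 : ~ J (Num.min l b - 1) by move=> /H; lra.
by case: HJ => [|[|[|[|]]]] JE; rewrite JE /= in H1 H2; lra.
Qed.

Lemma admissibleD (J : set R) x y : admissible_range J -> J x -> J y -> J (x + y).
Proof. by move=> [a [b [ab [|[|[|[|]]]]]]] -> //=; lra. Qed.

(** At least one term is present, since the empty sum [0] may lie outside [J]. *)
Lemma admissible_sum n (J : set R) (F : 'I_n.+1 -> R) : admissible_range J ->
  (forall i, J (F i)) -> J (\sum_i F i).
Proof.
move=> aJ; elim: n F => [|n IH] F JF; first by rewrite big_ord_recl big_ord0 addr0.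
by rewrite big_ord_recl; apply: admissibleD => //; exact: IH.
Qed.

End AdmissibleRange.

(** * Operations with an additive representation *)

Section InverseContinuity.
Context {R : realType}.

(** A point [x1] of [I] strictly between [x0] and [x0 + e] provides [d = phi x1 - phi x0]. Without
    one, convexity leaves no point of [I] at or above [x0 + e], and any [d] works. *)
Lemma increasing_inverse_upper (I : set R) (phi : R -> R) x0 e :
  is_interval I -> strictly_increasing_on I phi -> I x0 -> 0 < e ->
  exists2 d, 0 < d & forall x, I x -> phi x < phi x0 + d -> x < x0 + e.
Proof.
move=> hI phi_lt Ix0 e0.
have [[x1 [Ix1 x01 x1e]]|H] := pselect (exists x1, [/\ I x1, x0 < x1 & x1 < x0 + e]).
  exists (phi x1 - phi x0); first by rewrite subr_gt0 phi_lt.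
  move=> x Ix; rewrite addrC subrK => xx1; apply: lt_trans x1e.
  rewrite ltNge le_eqVlt; apply/negP => /predU1P[e1|/phi_lt]; first by rewrite e1 ltxx in xx1.
  by move=> /(_ Ix1 Ix); lra.
exists 1 => // x Ix _; rewrite ltNge; apply/negP => xe.
have Im : I (x0 + e / 2) by apply: (hI _ _ Ix0 Ix); lra.
by apply: H; exists (x0 + e / 2); split => //; lra.
Qed.

Lemma increasing_inverse_continuous (I : set R) (phi : R -> R) x0 e :
  is_interval I -> strictly_increasing_on I phi -> I x0 -> 0 < e ->
  exists2 d, 0 < d & forall x, I x -> `|phi x - phi x0| < d -> `|x - x0| < e.
Proof.
move=> hI phi_lt Ix0 e0.
have [d d0 hd] := increasing_inverse_upper hI phi_lt Ix0 e0.
have [||||d' d'0 hd'] :=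
  @increasing_inverse_upper [set x | I (- x)] (fun x => - phi (- x)) (- x0) e.
- move=> u v Iu Iv z /andP[uz zv]; apply: (hI _ _ Iv Iu); lra.
- by move=> u v Iu Iv uv; rewrite ltrN2 phi_lt// ltrN2.
- by rewrite /= opprK.
- by [].
exists (Num.min d d'); first by rewrite lt_min d0.
move=> x Ix; rewrite lt_min => /andP[]; rewrite !ltr_norml => h1 h2.
have := hd x Ix; have := hd' (- x); rewrite /= !opprK => /(_ Ix); lra.
Qed.

Lemma monotone_inverse_continuous (I : set R) (phi : R -> R) x0 e :
  is_interval I -> strictly_increasing_on I phi \/ strictly_decreasing_on I phi ->
  I x0 -> 0 < e ->
  exists2 d, 0 < d & forall x, I x -> `|phi x - phi x0| < d -> `|x - x0| < e.
Proof.
move=> hI [phi_lt|phi_gt] Ix0 e0; first exact: increasing_inverse_continuous.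
have [||||d d0 hd] := @increasing_inverse_continuous I (fun x => - phi x) x0 e => //.
  by move=> x y Ix Iy xy; rewrite ltrN2; exact: phi_gt.
by exists d => // x Ix h; apply: hd => //; rewrite -opprD normrN.
Qed.

End InverseContinuity.

(** * From an additive representation to the four properties *)

Section Converse.
Context {R : realType} {n : nat}.
Variables (I J : set R) (f : 'rV[R]_n.+1 -> R) (phi psi : R -> R).
Hypothesis hI : is_interval I.
Hypothesis fI : forall x, cube I x -> I (f x).
Hypothesis rep : additive_representation I f phi psi J.

Lemma representationE x : cube I x -> phi (f x) = \sum_i phi (x ord0 i).
Proof.
move=> Ix; case: rep => -[aJ phiI] _ _ [_ psiK] fE.
rewrite fE// (psiK _ _).2 //; apply: admissible_sum => // i.
by rewrite -phiI; exists (x ord0 i) => //; exact: Ix.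
Qed.

Lemma representation_symmetric : symmetric_on I f.
Proof.
move=> s x Ix; case: rep => _ _ _ _ fE.
rewrite !fE //; last by move=> i; rewrite mxE.
by congr psi; rewrite (reindex_inj (@perm_inj _ s)); apply: eq_bigr => i _; rewrite mxE.
Qed.

Lemma representation_cancellative : cancellative_on I f.
Proof.
move=> k x x' Ix Ix' xx' ffx.
have [_ _ _ [phiK _] _] := rep.
have := congr1 phi ffx; rewrite !representationE// (bigD1 k)//= [in RHS](bigD1 k)//=.
rewrite (eq_bigr (fun i => phi (x' ord0 i))); last by move=> i ik; rewrite xx'.
by move/addIr => e; rewrite -(phiK _ (Ix k)) e phiK.
Qed.

(** The right-hand side is free of [i], so associativity follows once [psi] inverts [phi]. *)
Lemma representation_assoc_term x i : (i < n.+1)%N ->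
  (forall k, (k < 2 * n.+1 - 1)%N -> I (x k)) ->
  phi (assoc_term f x i) = \sum_(0 <= k < 2 * n.+1 - 1) phi (x k).
Proof.
move=> i_n Ix.
have Iinner : cube I (\row_(k < n.+1) x (i + k)%N).
  by move=> k; rewrite mxE; apply: Ix; have := ltn_ord k; lia.
rewrite /assoc_term representationE; last first.
  move=> j; rewrite mxE; have jn := ltn_ord j; case: ifP => _; first by apply: Ix; lia.
  by case: ifP => [_|/eqP ji]; [exact: fI|apply: Ix; lia].
pose F j := phi (if (j < i)%N then x j
  else if j == i then f (\row_(k < n.+1) x (i + k)%N) else x (j + n.+1 - 1)%N).
rewrite (eq_bigr (fun j : 'I_n.+1 => F j)); last by move=> j _; rewrite mxE.
rewrite -(big_mkord xpredT F).
rewrite (@big_cat_nat _ _ _ i) //=; last exact: ltnW.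
rewrite (big_ltn i_n) /F ltnn eqxx representationE//.
rewrite [RHS](@big_cat_nat _ _ _ i) //=; last by lia.
congr (_ + _).
  by rewrite !big_nat; apply: eq_bigr => j /andP[_ ->].
rewrite [RHS](@big_cat_nat _ _ _ (i + n.+1)) //=; [|by lia|by lia].
congr (_ + _).
  rewrite (addnC i n.+1) -{2}[i]add0n big_addn addnK big_mkord.
  by apply: eq_bigr => k _; rewrite mxE addnC.
(* The inner block of [n.+1] entries fills a single outer slot, so an outer index [j > i] reads the
   word at [j + n]. *)
rewrite -addSnnS big_addn (_ : 2 * n.+1 - 1 - n = n.+1)%N; last by lia.
rewrite !big_nat; apply: eq_bigr => j /andP[ij _].
by rewrite ltnNge ltnW//= gtn_eqF// addnS subn1.
Qed.

Lemma representation_associative : associative_on I f.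
Proof.
move=> i x i_n Ix.
have [_ _ _ [phiK _] _] := rep.
have Iterm j : (j < n.+1)%N -> I (assoc_term f x j).
  move=> jn; apply: fI => k; rewrite mxE; have kn := ltn_ord k.
  case: ifP => _; first by apply: Ix; lia.
  case: ifP => [_|/eqP kj]; last by apply: Ix; lia.
  by apply: fI => l; rewrite mxE; apply: Ix; have := ltn_ord l; lia.
have i_n' : (i < n.+1)%N := ltnW i_n.
by rewrite -[LHS](phiK _ (Iterm _ i_n')) -[RHS](phiK _ (Iterm _ i_n)) !representation_assoc_term.
Qed.

(** The sum [phi (f u)] is continuous in [u]; continuity of the inverse of [phi] at [phi (f x)]
    carries this over to [f]. *)
Lemma representation_continuous : {within cube I, continuous f}.
Proof.
have [_ phi_cont phi_mono [phiK _] _] := rep.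
apply/subspace_continuousP => x Ix; apply/cvgrPdist_lt => e e0.
have [d d0 hd] := monotone_inverse_continuous hI phi_mono (fI Ix) e0.
have cS : (fun u : 'rV[R]_n.+1 => \sum_i phi (u ord0 i)) @ within (cube I) (nbhs x) -->
    \sum_i phi (x ord0 i).
  apply: (cvg_big add_continuous) => i _; apply/cvgrPdist_lt => r r0.
  have [q q0 hq] := (within_continuousP _ _).1 phi_cont _ (Ix i) r r0.
  rewrite near_withinE; apply/nbhs_ballP; exists q => //= u [_ xu] Iu.
  by rewrite distrC; apply: hq => //; rewrite distrC; exact: xu.
have /cvgrPdist_lt/(_ d d0) := cS; rewrite !near_withinE; apply: filterS => u hu Iu.
by rewrite distrC; apply: hd; [exact: fI|rewrite !representationE// distrC; exact: hu].
Qed.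

End Converse.

(** * Assembly of the equivalence and the open end *)

Lemma nary_representation (R : realType) (m : nat) (I : set R) (f : 'rV[R]_m.+2 -> R) :
  is_interval I -> (exists x y, I x /\ I y /\ x != y) ->
  (forall x, cube I x -> I (f x)) ->
  [/\ {within cube I, continuous f}, symmetric_on I f,
      cancellative_on I f & associative_on I f] ->
  exists (phi psi : R -> R) (J : set R),
    additive_representation I f phi psi J /\ strictly_increasing_on I phi.
Proof.
move=> hI nontriv fI [f_cont f_sym f_cancel f_assoc].
have [a [b [Ia [Ib ab]]]] := nontriv.
have [phi [phiD phi_lt phi_cont]] :=
  nary_additive hI nontriv fI f_cont f_sym f_cancel f_assoc Ia.
have phi_inj x y : I x -> I y -> phi x = phi y -> x = y.
  move=> Ix Iy e; apply/eqP; rewrite eq_le !leNgt; apply/andP.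
  by split; apply/negP => xy;
    [have := phi_lt _ _ Iy Ix xy|have := phi_lt _ _ Ix Iy xy]; rewrite e ltxx.
(* A chosen preimage in [I], with default 0 off the range of [phi]. *)
pose psi y := xget 0 [set x | I x /\ phi x = y].
have psiK y : (phi @` I) y -> I (psi y) /\ phi (psi y) = y.
  by move=> [x Ix e]; rewrite /psi; case: xgetP => [_ -> []//|/(_ x)]; case.
have phiK x : I x -> psi (phi x) = x.
  move=> Ix; have [|Ip e] := psiK (phi x); first by exists x.
  exact: phi_inj.
exists phi, psi, (phi @` I); split => //; split => //.
- split => //; apply: (@dilation_stable_admissible _ m.+2) => //.
  + exact: within_continuous_image_interval.
  (* On the diagonal, [phi (f (x, ..., x))] is [m.+2] times [phi x], so the range is stable under
     this dilation. *)
  + move=> _ [x Ix <-]; have cx : cube I (\row_(i < m.+2) x) by move=> i; rewrite mxE.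
    exists (f (\row_(i < m.+2) x)); first exact: fI.
    rewrite phiD// (eq_bigr (fun=> phi x)); last by move=> i _; rewrite mxE.
    by rewrite sumr_const card_ord mulr_natl.
  (* By injectivity [phi a] and [phi b] are not both zero. *)
  + have [e|] := eqVneq (phi a) 0; last by exists (phi a) => //; exists a.
    exists (phi b); first by exists b.
    by apply: contra ab; rewrite -e => /eqP/phi_inj ->.
- by left.
- by move=> x Ix; rewrite -phiD// phiK//; exact: fI.
Qed.

(** Attained extrema [a] and [b] of [I] would confine [J] between [phi a] and [phi b], whereas
    admissible ranges are unbounded. *)
Lemma representation_open_end (R : realType) (n : nat) (I J : set R)
    (f : 'rV[R]_n -> R) (phi psi : R -> R) :
  additive_representation I f phi psi J -> strictly_increasing_on I phi ->
  open_at_some_end I.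
Proof.
move=> [[aJ phiI] _ _ _ _] phi_lt [[a [Ia aI]] [b [Ib bI]]].
have phi_le x y : I x -> I y -> x <= y -> phi x <= phi y.
  by move=> Ix Iy; rewrite le_eqVlt => /predU1P[->//|/phi_lt xy]; exact/ltW/xy.
apply: (admissible_unbounded (l := phi a) (u := phi b) aJ) => y.
by rewrite -phiI => -[x Ix <-]; rewrite !phi_le// ?aI ?bI.
Qed.

Unset Implicit Arguments.
Set Strict Implicit.

Theorem mainTheorem1 (R : realType) (n : nat) (I : set R)
  (hn : (2 <= n)%N)
  (hI : is_interval I)
  (hI2 : exists x y, I x /\ I y /\ x != y)
  (f : 'rV[R]_n -> R)
  (hf : forall x, cube I x -> I (f x)) :
  ([/\ {within cube I, continuous f}, symmetric_on I f,
       cancellative_on I f & associative_on I f]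
   <-> exists (phi psi : R -> R) (J : set R),
         additive_representation I f phi psi J)
  /\
  ([/\ {within cube I, continuous f}, symmetric_on I f,
       cancellative_on I f & associative_on I f] ->
     open_at_some_end I /\
     exists (phi psi : R -> R) (J : set R),
       additive_representation I f phi psi J /\ strictly_increasing_on I phi).
Proof.
case: n hn f hf => [|[|m]] // _ f fI.
have fwd := nary_representation hI hI2 fI.
split; first split.
- by move=> /fwd[phi [psi [J [rep _]]]]; exists phi, psi, J.
- move=> [phi [psi [J rep]]]; split.
  + exact: representation_continuous rep.
  + exact: representation_symmetric rep.
  + exact: representation_cancellative rep.
  + exact: representation_associative rep.
- move=> /fwd[phi [psi [J [rep phi_lt]]]]; split; last by exists phi, psi, J.
  exact: representation_open_end rep phi_lt.
Qed.
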